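(* There is an absolute constant $C>0$ such that the following holds. Let $n\ge 1$ and let $P_1,\ldots,P_m$ be mutually commuting $n$-Pauli operators whose tableau $[X,Z]\in\mathbb{F}_2^{m\times 2n}$ has rank $n$ over $\mathbb{F}_2$. Then $P_1,\ldots,P_m$ can be simultaneously diagonalized by a circuit with stages H-CZ-S-H containing $\mathcal{O}(n^2)$ CZ gates. That is, there is a unitary $\mathcal{U}=U_4U_3U_2U_1$ on $n$ qubits, where $U_1$ is a product of Hadamard gates, $U_2$ is a product of at most $Cn^2$ CZ gates, $U_3$ is a product of phase gates $S$, and $U_4$ is a product of Hadamard gates (each acting on some of the $n$ qubits, with empty products allowed), such that for every $j\in\{1,\ldots,m\}$ the operator $\mathcal{U}P_j\mathcal{U}^\dagger$ is, up to a sign $\pm1$, a tensor product of $n$ matrices from $\{\sigma_i,\sigma_z\}$ (and hence diagonal).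
   Context: An $n$-Pauli operator is, up to a sign $\pm1$, a tensor product of $n$ matrices from $\{\sigma_i,\sigma_x,\sigma_y,\sigma_z\}$, where $\sigma_i$ is the $2\times 2$ identity and $\sigma_x,\sigma_y,\sigma_z$ are the Pauli matrices. Tableau: the list $P_1,\ldots,P_m$ is represented by binary matrices $X,Z\in\mathbb{F}_2^{m\times n}$ (together with a sign vector). The pair $(X_{i,j},Z_{i,j})$ encodes the $j$th tensor factor of $P_i$: $(0,0)$ for $\sigma_i$, $(1,0)$ for $\sigma_x$, $(0,1)$ for $\sigma_z$, $(1,1)$ for $\sigma_y$. The rank of the tableau is the rank of $[X,Z]$ over $\mathbb{F}_2$. Gates: the Hadamard gate is $H=\frac{1}{\sqrt2}\begin{pmatrix}1&1\\1&-1\end{pmatrix}$, the phase gate is $S=\begin{pmatrix}1&0\\0&i\end{pmatrix}$, both acting on one qubit, and the two-qubit controlled-Z gate is $\mathrm{CZ}=\mathrm{diag}(1,1,1,-1)$, acting on a pair of distinct qubits. Stages are listed in the order in which they are applied. *)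

(* Defs.v *)
From HB Require Import structures.
From mathcomp Require Import all_boot all_order all_algebra.
From mathcomp Require Import sesquilinear spectral.

Set Implicit Arguments.
Unset Strict Implicit.
Unset Printing Implicit Defensive.

Import Order.TTheory GRing.Theory Num.Theory.
Local Open Scope ring_scope.

(* Operators on n qubits are matrices of size 2 ^ n.  A basis index x < 2 ^ n
   stands for the basis vector |x_0 x_1 ... x_(n-1)>, where x_0 is the most
   significant bit; [qbit x j] is x_j. *)
Definition qbit n (x : 'I_(2 ^ n)) (j : 'I_n) : 'I_2 :=
  inord ((x %/ 2 ^ (n.-1 - j)) %% 2)%N.

Section Qubits.

Variable C : numClosedFieldType.

Definition mx2 (a b c d : C) : 'M[C]_2 :=
  \matrix_(i, j) nth 0 (nth [::] [:: [:: a; b]; [:: c; d]] i) j.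

Definition sigma_i : 'M[C]_2 := 1%:M.
Definition sigma_x : 'M[C]_2 := mx2 0 1
                                    1 0.
Definition sigma_y : 'M[C]_2 := mx2 0  (- 'i)
                                    'i 0.
Definition sigma_z : 'M[C]_2 := mx2 1 0
                                    0 (- 1).

Definition hadamard : 'M[C]_2 := (sqrtC 2)^-1 *: mx2 1 1
                                                     1 (- 1).
Definition phase : 'M[C]_2 := mx2 1 0
                                  0 'i.
Definition cz : 'M[C]_4 := diag_mx (\row_(i < 4) nth 0 [:: 1; 1; 1; - 1] i).

(* The Kronecker product of A_0, A_1, ..., A_(n-1), in this order. *)
Definition tensor n (A : 'I_n -> 'M[C]_2) : 'M[C]_(2 ^ n) :=
  \matrix_(x, y) \prod_(j < n) A j (qbit x j) (qbit y j).

Definition on_qubit n (g : 'M[C]_2) (q : 'I_n) : 'M[C]_(2 ^ n) :=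
  tensor (fun j => if j == q then g else 1%:M).

Definition pair_bits n (x : 'I_(2 ^ n)) (p : 'I_n * 'I_n) : 'I_4 :=
  inord (2 * qbit x p.1 + qbit x p.2)%N.

(* Meaningful only when the two qubits of p are distinct; the basis of the pair
   is ordered as |00>, |01>, |10>, |11>. *)
Definition on_qubits n (g : 'M[C]_4) (p : 'I_n * 'I_n) : 'M[C]_(2 ^ n) :=
  \matrix_(x, y) (g (pair_bits x p) (pair_bits y p) *
    \prod_(j < n | (j != p.1) && (j != p.2)) (qbit x j == qbit y j)%:R).

Definition H_stage n (qs : seq 'I_n) : 'M[C]_(2 ^ n) :=
  \big[mulmx/1%:M]_(q <- qs) on_qubit hadamard q.

Definition S_stage n (qs : seq 'I_n) : 'M[C]_(2 ^ n) :=
  \big[mulmx/1%:M]_(q <- qs) on_qubit phase q.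

Definition CZ_stage n (ps : seq ('I_n * 'I_n)) : 'M[C]_(2 ^ n) :=
  \big[mulmx/1%:M]_(p <- ps) on_qubits cz p.

Definition signed_tensor_of n (As : seq 'M[C]_2) (M : 'M[C]_(2 ^ n)) : Prop :=
  exists (s : bool) (A : 'I_n -> 'M[C]_2),
    (forall j, A j \in As) /\ M = (-1) ^+ s *: tensor A.

Definition is_pauli n (M : 'M[C]_(2 ^ n)) : Prop :=
  signed_tensor_of [:: sigma_i; sigma_x; sigma_y; sigma_z] M.

Definition pauli_factor (x z : 'F_2) : 'M[C]_2 :=
  if x == 0 then (if z == 0 then sigma_i else sigma_z)
  else (if z == 0 then sigma_x else sigma_y).

Definition is_tableau m n (P : 'I_m -> 'M[C]_(2 ^ n))
    (X Z : 'M['F_2]_(m, n)) (s : 'I_m -> bool) : Prop :=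
  forall i, P i = (-1) ^+ s i *: tensor (fun j => pauli_factor (X i j) (Z i j)).

End Qubits.

(* Main.v *)
(** Conjugation by H, S and CZ acts on tableau rows [(x, z)], up to a sign, by
    swapping [x_q] and [z_q], by [z_q += x_q], and by [z_p += x_q, z_q += x_p].
    Commutation of the operators says that the rows of [X, Z] span an isotropic,
    hence (rank n) Lagrangian, subspace.  Exchanging the X- and Z-columns outside
    a basis of the column space of X then gives X' of full column rank n:
    a combination of rows vanishing in X' has x = 0, so it is a vector (0, z)
    with z supported on the basis columns and X z^T = 0 by isotropy, so z = 0.
    Hence Z' = X' A, and isotropy forces A to be symmetric.  One CZ per pair
    i < j with A_ij = 1 and one S per diagonal entry of A clear Z', and
    Hadamards on all qubits turn (X', 0) into (0, X'). *)
Require Import Defs.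
From HB Require Import structures.
From mathcomp Require Import all_boot all_order all_algebra.
From mathcomp Require Import sesquilinear spectral.
From mathcomp Require Import zify ring.

Set Implicit Arguments.
Unset Strict Implicit.
Unset Printing Implicit Defensive.

Import Order.TTheory GRing.Theory Num.Theory.
Local Open Scope ring_scope.
Local Open Scope sesquilinear_scope.

(** * Basis indices and their bits *)

Lemma F2P (x : 'F_2) : x = 0 \/ x = 1.
Proof. by case: x => [[|[|//]] ?]; [left|right]; apply: val_inj. Qed.

Lemma eq_binary_digits n x y : (x < 2 ^ n)%N -> (y < 2 ^ n)%N ->
  (forall k, (k < n)%N -> ((x %/ 2 ^ k) %% 2 = (y %/ 2 ^ k) %% 2)%N) -> x = y.
Proof.
elim: n x y => [|n IHn] x y; first by rewrite expn0 !ltnS !leqn0 => /eqP-> /eqP->.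
rewrite expnS => ltx lty eqxy.
have low : (x %% 2 = y %% 2)%N by have := eqxy 0%N isT; rewrite expn0 !divn1.
suff high : (x %/ 2 = y %/ 2)%N.
  by rewrite (divn_eq x 2) (divn_eq y 2) low high.
apply: IHn => [||k ltk]; try by rewrite ltn_divLR // mulnC.
by have := eqxy k.+1 ltk; rewrite expnS !divnMA.
Qed.

Lemma qbitP n (x y : 'I_(2 ^ n)) : (forall j, qbit x j = qbit y j) -> x = y.
Proof.
move=> eqxy; apply: val_inj; apply: (eq_binary_digits (ltn_ord x) (ltn_ord y)) => k ltkn.
(* Qubit 0 holds the most significant bit, so the digit of weight [2 ^ k] belongs to qubit
   [n.-1 - k]. *)
have ltj : (n.-1 - k < n)%N by lia.
have /(congr1 val) := eqxy (Ordinal ltj).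
rewrite /= !inordK ?ltn_mod //.
by have -> : (n.-1 - (n.-1 - k) = k)%N by lia.
Qed.

(** Injective by [qbitP], between sets of equal size [2 ^ n]; it lets sums over basis indices be
    rewritten as sums over bit assignments. *)
Lemma qbit_bij n :
  bijective (fun x : 'I_(2 ^ n) => [ffun j : 'I_n => qbit x j]).
Proof.
apply: inj_card_bij => [x y /ffunP eqxy|].
  by apply: qbitP => j; have := eqxy j; rewrite !ffunE.
by rewrite card_ffun !card_ord.
Qed.

(** * Algebra of Kronecker products *)

Section Tensor.
Variable C : numClosedFieldType.
Implicit Types n : nat.

Lemma eq_tensor n (A B : 'I_n -> 'M[C]_2) : A =1 B -> tensor A = tensor B.
Proof.
by move=> eqAB; apply/matrixP => x y; rewrite !mxE; apply: eq_bigr => j _; rewrite eqAB.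
Qed.

(** Distributing the product of the factorwise sums gives one sum over all choices of intermediate
    bits, which by [qbit_bij] are the intermediate basis indices. *)
Lemma mul_tensor n (A B : 'I_n -> 'M[C]_2) :
  tensor A *m tensor B = tensor (fun j => A j *m B j).
Proof.
apply/matrixP => x y; rewrite !mxE.
under [RHS]eq_bigr do rewrite mxE.
rewrite bigA_distr_bigA /= (reindex _ (onW_bij _ (qbit_bij n))) /=.
by apply: eq_bigr => z _; rewrite !mxE -big_split; apply: eq_bigr => j _; rewrite ffunE.
Qed.

Lemma tensor1 n : tensor (fun=> 1%:M) = 1%:M :> 'M[C]_(2 ^ n).
Proof.
apply/matrixP => x y; rewrite !mxE.
have [->|neq] := eqVneq x y; first by rewrite big1 // => j _; rewrite mxE eqxx.
have [j /negPf neqj] : exists j, qbit x j != qbit y j.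
  apply/existsP; rewrite -negb_forall; apply: contra neq => /forallP eqxy.
  by apply/eqP/qbitP => j; apply/eqP.
by rewrite (bigD1 j) //= mxE neqj mul0r.
Qed.

Lemma scale_tensor n (k : 'I_n -> C) (A : 'I_n -> 'M[C]_2) :
  tensor (fun j => k j *: A j) = (\prod_j k j) *: tensor A.
Proof.
by apply/matrixP => x y; rewrite !mxE -big_split; apply: eq_bigr => j _; rewrite mxE.
Qed.

Lemma adj_tensor n (A : 'I_n -> 'M[C]_2) :
  (tensor A)^t* = tensor (fun j => (A j)^t*).
Proof.
apply/matrixP => x y; rewrite !mxE rmorph_prod.
by apply: eq_bigr => j _; rewrite !mxE.
Qed.

Lemma conj_tensor n (A B : 'I_n -> 'M[C]_2) :
  tensor A *m tensor B *m (tensor A)^t* =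
    tensor (fun j => A j *m B j *m (A j)^t*).
Proof. by rewrite adj_tensor !mul_tensor. Qed.

Lemma tensor_unitary n (A : 'I_n -> 'M[C]_2) :
  (forall j, A j \is unitarymx) -> tensor A \is unitarymx.
Proof.
move=> uA; apply/unitarymxP; rewrite adj_tensor mul_tensor -tensor1.
by apply: eq_tensor => j; apply/unitarymxP.
Qed.

End Tensor.

(** * Single-qubit gates and Pauli matrices *)

Section Matrices2.
Variable C : numClosedFieldType.

Lemma mx2P (A B : 'M[C]_2) :
  A 0 0 = B 0 0 -> A 0 1 = B 0 1 -> A 1 0 = B 1 0 -> A 1 1 = B 1 1 -> A = B.
Proof.
move=> e00 e01 e10 e11; apply/matrixP => i j.
(* ['F_2] is convertible with ['I_2], so [F2P] also splits on matrix indices and bits. *)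
by case: (F2P i) => ->; case: (F2P j) => ->.
Qed.

Lemma mul_mx2 a b c d a' b' c' d' :
  mx2 a b c d *m mx2 a' b' c' d' =
    mx2 (a * a' + b * c') (a * b' + b * d')
        (c * a' + d * c') (c * b' + d * d') :> 'M[C]_2.
Proof. by apply: mx2P; rewrite mxE big_ord_recl big_ord1 !mxE. Qed.

Lemma scale_mx2 k a b c d :
  k *: mx2 a b c d = mx2 (k * a) (k * b) (k * c) (k * d) :> 'M[C]_2.
Proof. by apply: mx2P; rewrite !mxE. Qed.

Lemma adj_mx2 a b c d :
  (mx2 a b c d)^t* = mx2 a^* c^* b^* d^* :> 'M[C]_2.
Proof. by apply: mx2P; rewrite !mxE. Qed.

Lemma mx2_1 : 1%:M = mx2 1 0 0 1 :> 'M[C]_2.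
Proof. by apply: mx2P; rewrite !mxE. Qed.

Lemma sqr_invsqrt2 : (sqrtC 2)^-1 * (sqrtC 2)^-1 = 2^-1 :> C.
Proof. by rewrite -expr2 exprVn sqrtCK. Qed.

Lemma conj_invsqrt2 : ((sqrtC 2)^-1)^* = (sqrtC 2)^-1 :> C.
Proof. by apply/CrealP; rewrite realV ger0_real // sqrtC_ge0. Qed.

(** The two factors [(sqrtC 2)^-1] merge into [2^-1], so later computations are free of square
    roots. *)
Lemma hadamard_conj (A : 'M[C]_2) :
  hadamard C *m A *m (hadamard C)^t* =
    2^-1 *: (mx2 1 1 1 (-1) *m A *m mx2 1 1 1 (-1)).
Proof.
rewrite /hadamard linearZ /= map_mxZ /= conj_invsqrt2 adj_mx2 rmorphN /= !conjC1.
by rewrite -scalemxAl -scalemxAl -scalemxAr scalerA sqr_invsqrt2.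
Qed.

Lemma hadamard_unitary : hadamard C \is unitarymx.
Proof.
apply/unitarymxP; rewrite -[X in X *m _]mulmx1 hadamard_conj mx2_1.
have n2 : 2 != 0 :> C by rewrite pnatr_eq0.
by rewrite !mul_mx2 scale_mx2; congr mx2; field.
Qed.

Lemma phase_unitary : phase C \is unitarymx.
Proof.
apply/unitarymxP; rewrite adj_mx2 mul_mx2 mx2_1 conjCi.
have i2 : 'i * 'i = -1 :> C by rewrite -expr2 sqrCi.
by rewrite conjC0 conjC1; congr mx2; ring: i2.
Qed.

(** Conjugation exchanges [sigma_x] and [sigma_z]; only [sigma_y] picks up a sign. *)
Lemma hadamard_pauli (x z : 'F_2) :
  hadamard C *m pauli_factor C x z *m (hadamard C)^t* =
    (-1) ^+ ((x != 0) && (z != 0)) *: pauli_factor C z x.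
Proof.
have n2 : 2 != 0 :> C by rewrite pnatr_eq0.
rewrite hadamard_conj /pauli_factor /sigma_i /sigma_x /sigma_y /sigma_z mx2_1.
case: (F2P x) => ->; case: (F2P z) => -> /=; rewrite !mul_mx2 !scale_mx2;
  by congr mx2; field.
Qed.

(** Conjugation sends [sigma_x] to [sigma_y] and [sigma_y] to [- sigma_x], and fixes the diagonal
    factors. *)
Lemma phase_pauli (x z : 'F_2) :
  phase C *m pauli_factor C x z *m (phase C)^t* =
    (-1) ^+ ((x != 0) && (z != 0)) *: pauli_factor C x (z + x).
Proof.
rewrite /phase adj_mx2 conjC0 conjC1 conjCi.
rewrite /pauli_factor /sigma_i /sigma_x /sigma_y /sigma_z mx2_1.
have i2 : 'i * 'i = -1 :> C by rewrite -expr2 sqrCi.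
case: (F2P x) => ->; case: (F2P z) => -> /=; rewrite !mul_mx2 !scale_mx2;
  by congr mx2; ring: i2.
Qed.

(** The exponent is the symplectic form of the two bit pairs, read as the number 0 or 1. *)
Lemma pauli_commute (x z x' z' : 'F_2) :
  pauli_factor C x z *m pauli_factor C x' z' =
    (-1) ^+ (x * z' + z * x')%R *:
      (pauli_factor C x' z' *m pauli_factor C x z).
Proof.
rewrite /pauli_factor /sigma_i /sigma_x /sigma_y /sigma_z mx2_1.
have i2 : 'i * 'i = -1 :> C by rewrite -expr2 sqrCi.
case: (F2P x) => ->; case: (F2P z) => ->;
case: (F2P x') => ->; case: (F2P z') => -> /=; rewrite !mul_mx2 !scale_mx2;
  by congr mx2; ring: i2.
Qed.

Lemma pauli_unitary (x z : 'F_2) : pauli_factor C x z \is unitarymx.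
Proof.
apply/unitarymxP.
rewrite /pauli_factor /sigma_i /sigma_x /sigma_y /sigma_z mx2_1.
have i2 : 'i * 'i = -1 :> C by rewrite -expr2 sqrCi.
case: (F2P x) => ->; case: (F2P z) => -> /=; rewrite adj_mx2 mul_mx2;
  by rewrite ?rmorphN /= ?conjC0 ?conjC1 ?conjCi; congr mx2; ring: i2.
Qed.

End Matrices2.

(** * The controlled-Z gate *)

Section CZ.
Variable C : numClosedFieldType.

(** CZ is not a tensor product, so its conjugation is computed entrywise: the outer signs are its
    diagonal entries. A sign appears only for [sigma_x] paired with [sigma_y], in either order. *)
Lemma cz_pauli (x z x' z' : 'F_2) (i j i' j' : 'I_2) :
  (-1) ^+ (i * i') * (pauli_factor C x z i j * pauli_factor C x' z' i' j')
      * (-1) ^+ (j * j') =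
    (-1) ^+ (x * x' * (z + z'))%R *
      (pauli_factor C x (z + x') i j * pauli_factor C x' (z' + x) i' j').
Proof.
have i2 : 'i * 'i = -1 :> C by rewrite -expr2 sqrCi.
rewrite /pauli_factor /sigma_i /sigma_x /sigma_y /sigma_z mx2_1.
case: (F2P x) => ->; case: (F2P z) => ->;
case: (F2P x') => ->; case: (F2P z') => -> /=;
case: (F2P i) => ->; case: (F2P j) => ->;
case: (F2P i') => ->; case: (F2P j') => ->; rewrite !mxE /=; ring: i2.
Qed.

Lemma eq_pair_bits n (x y : 'I_(2 ^ n)) p :
  (pair_bits x p == pair_bits y p) =
    (qbit x p.1 == qbit y p.1) && (qbit x p.2 == qbit y p.2).
Proof.
rewrite /pair_bits.
case: (F2P (qbit x p.1)) => ->; case: (F2P (qbit x p.2)) => ->;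
case: (F2P (qbit y p.1)) => ->; case: (F2P (qbit y p.2)) => ->;
by rewrite -val_eqE /= !inordK.
Qed.

Lemma on_qubits_czE n (p : 'I_n * 'I_n) : p.1 != p.2 ->
  on_qubits (cz C) p =
    diag_mx (\row_x (-1) ^+ (qbit x p.1 * qbit x p.2)%N).
Proof.
move=> neq; apply/matrixP => x y; rewrite !mxE eq_pair_bits.
(* Equality of [x] and [y] splits into agreement on the pair and on [others]; the product of
   Kronecker deltas is the truth value of the latter. *)
pose others := [forall (j | (j != p.1) && (j != p.2)), qbit x j == qbit y j].
have -> : (x == y) = [&& qbit x p.1 == qbit y p.1, qbit x p.2 == qbit y p.2 &
    others].
  rewrite /others; apply/eqP/and3P => [->|[/eqP e1 /eqP e2 /forallP eqxy]].
    by split=> //; apply/forallP => j; apply/implyP.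
  apply: qbitP => j; have [->//|n1] := eqVneq j p.1.
  have [->//|n2] := eqVneq j p.2.
  by have /implyP := eqxy j; rewrite n1 n2 => /(_ isT)/eqP.
have -> : \prod_(j < n | (j != p.1) && (j != p.2)) (qbit x j == qbit y j)%:R =
    others%:R :> C.
  have [/forallP eqxy|] := boolP others.
    by rewrite big1 // => j nj; have /implyP/(_ nj) -> := eqxy j.
  rewrite negb_forall => /existsP[j]; rewrite negb_imply => /andP[nj /negPf neqj].
  by rewrite (bigD1 j) //= neqj mul0r.
rewrite mulr_natr -mulrnA mulnb andbA; congr (_ *+ _).
rewrite /pair_bits.
by case: (F2P (qbit x p.1)) => ->; case: (F2P (qbit x p.2)) => ->;
  rewrite inordK //= ?expr0 ?expr1.
Qed.

Lemma adj_sign_diag n (e : 'I_n -> nat) :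
  (diag_mx (\row_x (-1) ^+ e x))^t* = diag_mx (\row_x (-1) ^+ e x) :> 'M[C]_n.
Proof.
rewrite tr_diag_mx; apply/matrixP => x y.
by rewrite !mxE rmorphMn rmorphXn rmorphN /= conjC1.
Qed.

End CZ.

(** * Action of the stages on tableau rows *)

Section Action.
Variables (C : numClosedFieldType) (n : nat).
Notation tableau_row := ('rV['F_2]_n * 'rV['F_2]_n)%type.
Implicit Types v : tableau_row.

Definition pauli v : 'M[C]_(2 ^ n) :=
  tensor (fun j => pauli_factor C (v.1 0 j) (v.2 0 j)).

(** The sign is left existential, since the final claim is up to sign; unitarity is carried along so
    that both compose stage by stage. *)
Definition acts_as (U : 'M[C]_(2 ^ n)) (f : tableau_row -> tableau_row) : Prop :=
  U \is unitarymx /\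
  forall v, exists e : nat, U *m pauli v *m U^t* = (-1) ^+ e *: pauli (f v).

Lemma acts_as_ext U f g : f =1 g -> acts_as U f -> acts_as U g.
Proof. by move=> eqfg [uU actU]; split=> // v; rewrite -eqfg. Qed.

Lemma acts_as1 : acts_as 1%:M id.
Proof.
have adj1 : (1%:M : 'M[C]_(2 ^ n))^t* = 1%:M by rewrite trmx1 map_mx1.
split; first by apply/unitarymxP; rewrite adj1 mulmx1.
by move=> v; exists 0%N; rewrite adj1 mul1mx mulmx1 scale1r.
Qed.

Lemma acts_as_mul U V f g :
  acts_as U f -> acts_as V g -> acts_as (U *m V) (f \o g).
Proof.
move=> [uU actU] [uV actV]; split=> [|v]; first exact: mul_unitarymx.
have [e Ve] := actV v; have [e' Ue] := actU (g v); exists (e + e')%N.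
rewrite trmx_mul map_mxM !mulmxA -(mulmxA U) -(mulmxA U) Ve.
by rewrite -scalemxAr -scalemxAl Ue scalerA exprD.
Qed.

Lemma on_qubit_acts (g : 'M[C]_2) (f : 'F_2 -> 'F_2 -> 'F_2 * 'F_2)
    (b : 'F_2 -> 'F_2 -> bool) (q : 'I_n) :
  g \is unitarymx ->
  (forall x z, g *m pauli_factor C x z *m g^t* =
     (-1) ^+ b x z *: pauli_factor C (f x z).1 (f x z).2) ->
  acts_as (on_qubit g q)
    (fun v => (\row_j if j == q then (f (v.1 0 j) (v.2 0 j)).1 else v.1 0 j,
               \row_j if j == q then (f (v.1 0 j) (v.2 0 j)).2 else v.2 0 j)).
Proof.
move=> ug fg; split=> [|v].
  apply: tensor_unitary => j; case: eqP => // _.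
  by apply/unitarymxP; rewrite trmx1 map_mx1 mulmx1.
exists (b (v.1 0 q) (v.2 0 q) : nat); rewrite conj_tensor.
(* The global sign is spread as a product whose only nontrivial factor sits at [q], so that
   [scale_tensor] moves it inside. *)
have -> : (-1) ^+ b (v.1 0 q) (v.2 0 q) =
    \prod_j (if j == q then (-1) ^+ b (v.1 0 q) (v.2 0 q) else 1) :> C.
  by rewrite -big_mkcond big_pred1_eq.
rewrite -scale_tensor; apply: eq_tensor => j; rewrite !mxE.
case: eqP => [->|_]; first exact: fg.
by rewrite mul1mx trmx1 map_mx1 mulmx1 scale1r.
Qed.

Definition swap_on (qs : {pred 'I_n}) v : tableau_row :=
  (\row_j (if j \in qs then v.2 0 j else v.1 0 j),
   \row_j (if j \in qs then v.1 0 j else v.2 0 j)).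

(** Common form of the S and CZ actions; shears compose by adding their matrices, so the two stages
    merge into one. *)
Definition shear (A : 'M['F_2]_n) v : tableau_row := (v.1, v.2 + v.1 *m A).

Lemma row_mul_delta (u : 'rV['F_2]_n) (i k j : 'I_n) :
  (u *m delta_mx i k) 0 j = u 0 i *+ (j == k).
Proof.
rewrite mxE (bigD1 i) //= big1 => [|l /negPf nl]; last by rewrite mxE nl mulr0.
by rewrite mxE eqxx addr0 mulr_natr.
Qed.

Lemma shear_comp A B v : shear A (shear B v) = shear (A + B) v.
Proof. by rewrite /shear /= mulmxDr addrA addrAC. Qed.

(** Two Hadamards on one qubit would cancel, whereas [swap_on] sees only membership; hence
    [uniq]. *)
Lemma H_stage_acts qs : uniq qs -> acts_as (H_stage C qs) (swap_on (mem qs)).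
Proof.
elim: qs => [_|q qs IHqs /= /andP[nq uqs]].
  rewrite /H_stage big_nil; apply: acts_as_ext acts_as1 => -[x z].
  by congr pair; apply/rowP => j; rewrite mxE.
rewrite /H_stage big_cons.
have actq := @on_qubit_acts _ (fun x z => (z, x)) _ q (hadamard_unitary C)
  (@hadamard_pauli C).
apply: acts_as_ext (acts_as_mul actq (IHqs uqs)) => v.
by congr pair; apply/rowP => j; rewrite !mxE !inE /=;
  case: eqP => [->|//]; rewrite (negPf nq).
Qed.

Lemma S_stage_acts qs :
  acts_as (S_stage C qs) (shear (\sum_(q <- qs) delta_mx q q)).
Proof.
elim: qs => [|q qs IHqs].
  rewrite /S_stage !big_nil; apply: acts_as_ext acts_as1 => -[x z].
  by rewrite /shear mulmx0 addr0.
rewrite /S_stage !big_cons.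
have actq := @on_qubit_acts _ (fun x z => (x, z + x)) _ q (phase_unitary C)
  (@phase_pauli C).
apply: acts_as_ext (acts_as_mul actq IHqs) => v; rewrite -shear_comp /=.
congr pair; apply/rowP => j; first by rewrite mxE; case: ifP.
rewrite [RHS]mxE row_mul_delta [LHS]mxE.
by case: eqP => [->|_]; rewrite ?addr0.
Qed.

Lemma on_qubits_cz_acts (p : 'I_n * 'I_n) : p.1 != p.2 ->
  acts_as (on_qubits (cz C) p) (shear (delta_mx p.1 p.2 + delta_mx p.2 p.1)).
Proof.
move=> neq; rewrite on_qubits_czE //; split=> [|v].
  apply/unitarymxP; rewrite adj_sign_diag; apply/matrixP => x y.
  by rewrite mul_diag_mx !mxE mulrnAr -expr2 sqrr_sign.
exists (v.1 0 p.1 * v.1 0 p.2 * (v.2 0 p.1 + v.2 0 p.2))%R.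
set w := shear _ v.
have wE j : w.2 0 j = v.2 0 j + (v.1 0 p.1 *+ (j == p.2) + v.1 0 p.2 *+ (j == p.1)).
  by rewrite mxE mulmxDr [X in _ + X]mxE !row_mul_delta.
rewrite adj_sign_diag mul_diag_mx mul_mx_diag; apply/matrixP => x y.
(* The two qubits of [p] are split off: [cz_pauli] treats them, and the other factors are
   unchanged. *)
have pauliE u : pauli u x y =
    pauli_factor C (u.1 0 p.1) (u.2 0 p.1) (qbit x p.1) (qbit y p.1) *
    pauli_factor C (u.1 0 p.2) (u.2 0 p.2) (qbit x p.2) (qbit y p.2) *
    \prod_(j | (j != p.1) && (j != p.2))
      pauli_factor C (u.1 0 j) (u.2 0 j) (qbit x j) (qbit y j).
  by rewrite mxE (bigD1 p.1) //= (bigD1 p.2) /= ?mulrA // eq_sym.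
have others : \prod_(j | (j != p.1) && (j != p.2))
      pauli_factor C (w.1 0 j) (w.2 0 j) (qbit x j) (qbit y j) =
    \prod_(j | (j != p.1) && (j != p.2))
      pauli_factor C (v.1 0 j) (v.2 0 j) (qbit x j) (qbit y j).
  by apply: eq_bigr => j /andP[/negPf n1 /negPf n2]; rewrite wE n1 n2 !addr0.
rewrite 2!mxE [in RHS]mxE pauliE pauliE others !wE !eqxx [p.2 == p.1]eq_sym (negPf neq).
rewrite addr0 add0r [in RHS]mulrA -cz_pauli !mxE; ring.
Qed.

Lemma CZ_stage_acts ps : all (fun p => p.1 != p.2) ps ->
  acts_as (CZ_stage C ps)
    (shear (\sum_(p <- ps) (delta_mx p.1 p.2 + delta_mx p.2 p.1))).
Proof.
elim: ps => [_|p ps IHps /= /andP[neq dps]].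
  rewrite /CZ_stage !big_nil; apply: acts_as_ext acts_as1 => -[x z].
  by rewrite /shear mulmx0 addr0.
rewrite /CZ_stage !big_cons.
apply: acts_as_ext (acts_as_mul (on_qubits_cz_acts neq) (IHps dps)) => v.
exact: shear_comp.
Qed.

End Action.

(** * Isotropy, column exchange and symmetric matrices *)

Lemma F2_add_eq0 (x y : 'F_2) : x + y = 0 -> x = y.
Proof. by case: (F2P x) => ->; case: (F2P y) => ->. Qed.

Lemma F2_addxx n (u : 'rV['F_2]_n) : u + u = 0.
Proof. by apply/rowP => j; rewrite !mxE; case: (F2P (u 0 j)) => ->; apply: val_inj. Qed.

Lemma pauli_comm_isotropic (C : numClosedFieldType) n (v w : 'rV['F_2]_n * 'rV['F_2]_n) :
  comm_mx (pauli C v) (pauli C w) ->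
  \sum_j (v.1 0 j * w.2 0 j + v.2 0 j * w.1 0 j) = 0.
Proof.
pose c j : 'F_2 := v.1 0 j * w.2 0 j + v.2 0 j * w.1 0 j; pose N := (\sum_j (c j : nat))%N.
have anticomm : pauli C v *m pauli C w = (-1) ^+ N *: (pauli C w *m pauli C v).
  rewrite /pauli !mul_tensor -prodrXr -scale_tensor; apply: eq_tensor => j.
  exact: pauli_commute.
rewrite /comm_mx => comm_vw.
have unit_wv : pauli C w *m pauli C v \in unitmx.
  by rewrite unitmx_mul !unitarymx_unit ?tensor_unitary // => j; apply: pauli_unitary.
(* For odd [N] the invertible product would equal its own negative, hence vanish. *)
have even_N : ~~ odd N.
  apply/negP => oddN; move: anticomm; rewrite comm_vw -signr_odd oddN scaleN1r.
  move/eqP; rewrite -addr_eq0 -mulr2n -scaler_nat scaler_eq0 pnatr_eq0 /= => /eqP wv0.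
  have := mulmxV unit_wv; rewrite wv0 mul0mx => /matrixP.
  have lt0 : (0 < 2 ^ n)%N by rewrite expn_gt0.
  move/(_ (Ordinal lt0) (Ordinal lt0)); rewrite !mxE eqxx => /eqP.
  by rewrite eq_sym oner_eq0.
(* The symplectic form is thus [N] reduced modulo 2. *)
transitivity (\sum_j (c j : nat)%:R : 'F_2).
  by apply: eq_bigr => j _; rewrite -[LHS]/(c j); case: (F2P (c j)) => ->.
rewrite -natr_sum -/N -(odd_double_half N) (negPf even_N) add0n -muln2 natrM.
have -> : 2%:R = 0 :> 'F_2 by apply: val_inj.
by rewrite mulr0.
Qed.

(** [I] indexes a column basis of [X]; the first Hadamard stage will act on its complement. *)
Lemma row_full_exchange (F : finFieldType) m n (X Z : 'M[F]_(m, n)) :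
  X *m Z^T = Z *m X^T -> \rank (row_mx X Z) = n ->
  exists I : {set 'I_n}, row_full (\matrix_(i, j) if j \in I then X i j else Z i j).
Proof.
move=> sympXZ rankXZ.
(* Dual form of the columns in [I] spanning the column space of [X]. It is a boolean, as [F] is
   finite, so a smallest such [I] can be chosen. *)
pose detects (I : {set 'I_n}) :=
  [forall v : 'rV_m, [forall (j | j \in I), (v *m X) 0 j == 0] ==> (v *m X == 0)].
have detectsP I (v : 'rV_m) : detects I -> (forall j, j \in I -> (v *m X) 0 j = 0) -> v *m X = 0.
  move=> /forallP/(_ v)/implyP detI vX0; apply/eqP/detI/forallP => j.
  by apply/implyP => /vX0->.
have detectsT : detects setT.
  apply/forallP => v; apply/implyP => /forallP vX0; apply/eqP/rowP => j.
  by rewrite [RHS]mxE; apply/eqP/(implyP (vX0 j)); rewrite inE.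
(* A minimal detecting set of columns of [X] is linearly independent. *)
have [I detI minI] := arg_minnP (fun I : {set 'I_n} => #|I|) detectsT.
(* If [w i] were nonzero, column [i] would be a combination of the others in [I], and [I :\ i] would
   still detect. *)
have freeI (w : 'cV_n) : (forall j, j \notin I -> w j 0 = 0) -> X *m w = 0 -> w = 0.
  move=> suppw Xw0; apply/colP => i; rewrite [RHS]mxE; apply/eqP/negPn/negP => wi.
  have Ii : i \in I by apply: contraR wi => /suppw->.
  suff /minI : detects (I :\ i) by rewrite [X in (X <= _)%N](cardsD1 i I) Ii ltnn.
  apply/forallP => v; apply/implyP => /forallP vX0; apply/eqP/(detectsP I) => // j Ij.
  have [->|ji] := eqVneq j i; last by apply/eqP/(implyP (vX0 j)); rewrite !inE ji.
  have /matrixP/(_ 0 0) : v *m X *m w = 0 by rewrite -mulmxA Xw0 mulmx0.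
  rewrite mxE [RHS]mxE (bigD1 i) //= big1 ?addr0 => [/eqP|k ki].
    by rewrite mulf_eq0 (negPf wi) orbF => /eqP.
  have [Ik|/suppw->] := boolP (k \in I); last by rewrite mulr0.
  by have /implyP/(_ _)/eqP-> := vX0 k; rewrite ?mul0r // !inE ki.
exists I; set X' := \matrix_(i, j) _.
have mulX' (v : 'rV_m) j :
    (v *m X') 0 j = if j \in I then (v *m X) 0 j else (v *m Z) 0 j.
  by case: ifP => Ij; rewrite !mxE; apply: eq_bigr => k _; rewrite mxE Ij.
have kerX' (v : 'rV_m) : v *m X' = 0 -> v *m row_mx X Z = 0.
  move=> /rowP vX'0.
  have vX0 : v *m X = 0.
    by apply: detectsP detI _ => j Ij; have := vX'0 j; rewrite mulX' Ij [RHS]mxE.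
  suff /(congr1 trmx) : (v *m Z)^T = 0.
    by rewrite trmxK trmx0 mul_mx_row vX0 => ->; rewrite row_mx0.
  apply: freeI => [j nIj|].
    by have := vX'0 j; rewrite mulX' (negPf nIj) [RHS]mxE => vZ0; rewrite mxE.
  by rewrite trmx_mul mulmxA sympXZ -mulmxA -trmx_mul vX0 trmx0 mulmx0.
(* The rows of [1 - X' *m pinvmx X'] annihilate [X'], hence [[X, Z]] by [kerX']; the factorization
   bounds the rank of [X'] below by [n]. *)
have XZ_sub : row_mx X Z = X' *m (pinvmx X' *m row_mx X Z).
  apply/eqP; rewrite -subr_eq0 mulmxA -[X in X - _]mul1mx -mulmxBl; apply/eqP.
  apply/row_matrixP => i; rewrite row_mul row0; apply: kerX'.
  by rewrite -row_mul mulmxBl mul1mx mulmxKpV ?submx_refl // subrr row0.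
by rewrite /row_full eqn_leq rank_leq_col -{1}rankXZ XZ_sub mxrankM_maxl.
Qed.

Lemma sum_filter_F2 n (A : 'M['F_2]_n) (c : pred ('I_n * 'I_n))
    (E : 'I_n * 'I_n -> 'M['F_2]_n) :
  \sum_(p | c p && (A p.1 p.2 != 0)) E p = \sum_(p | c p) A p.1 p.2 *: E p.
Proof.
rewrite big_mkcondr; apply: eq_bigr => p _.
by case: (F2P (A p.1 p.2)) => ->; rewrite ?scale0r ?scale1r.
Qed.

(** Matches [S_stage_acts] and [CZ_stage_acts]: one phase gate per diagonal 1, one CZ per 1 above
    the diagonal. *)
Lemma symmetric_F2_sum n (A : 'M['F_2]_n) : A^T = A ->
  A = \sum_(q | A q q != 0) delta_mx q q +
      \sum_(p : 'I_n * 'I_n | (p.1 < p.2)%N && (A p.1 p.2 != 0))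
        (delta_mx p.1 p.2 + delta_mx p.2 p.1).
Proof.
move=> symA; rewrite sum_filter_F2.
under [X in _ = _ + X]eq_bigr do rewrite scalerDr.
rewrite big_split /=.
rewrite {1}[A]matrix_sum_delta pair_bigA /=.
rewrite (bigID (fun p : 'I_n * 'I_n => p.1 == p.2)) /=; congr (_ + _).
  rewrite (reindex (fun q => (q, q))) /=; last first.
    by exists fst => [q _|[q q'] /eqP /= ->].
  rewrite [RHS]big_mkcond; apply: eq_big => q; rewrite ?eqxx // => _.
  by case: (F2P (A q q)) => ->; rewrite ?scale0r ?scale1r.
rewrite (bigID (fun p : 'I_n * 'I_n => (p.1 < p.2)%N)) /=; congr (_ + _).
  by apply: eq_bigl => p; rewrite -val_eqE /=; lia.
(* The entries below the diagonal are folded onto those above by symmetry. *)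
rewrite (reindex (fun p => (p.2, p.1))) /=; last by exists (fun p => (p.2, p.1)) => -[].
apply: eq_big => [p|p _]; first by rewrite -val_eqE /=; lia.
by rewrite -{1}symA mxE.
Qed.

Theorem theorem4p3 :
  exists c : nat, (0 < c)%N /\
  forall (C : numClosedFieldType) (m n : nat) (P : 'I_m -> 'M[C]_(2 ^ n))
    (X Z : 'M['F_2]_(m, n)) (s : 'I_m -> bool),
    (1 <= n)%N ->
    (forall i, is_pauli (P i)) ->
    (forall i j, comm_mx (P i) (P j)) ->
    is_tableau P X Z s ->
    \rank (row_mx X Z) = n ->
    exists (h1 : seq 'I_n) (cz2 : seq ('I_n * 'I_n)) (ph3 h4 : seq 'I_n),
      let U := H_stage C h4 *m S_stage C ph3 *m CZ_stage C cz2 *m H_stage C h1 in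
      [/\ all (fun p => p.1 != p.2) cz2,
          (size cz2 <= c * n ^ 2)%N,
          U \is unitarymx
        & forall j, signed_tensor_of [:: sigma_i C; sigma_z C]
                      (U *m P j *m U ^t*)].

Proof.
(* The constant 1 suffices: the CZ gates form a set of pairs, of which there are [n ^ 2]. *)
exists 1%N; split=> // C m n P X Z s _ _ commP tabP rankXZ.
pose v i := (row i X, row i Z).
have PE i : P i = (-1) ^+ s i *: pauli C (v i).
  by rewrite tabP; congr (_ *: _); apply: eq_tensor => j; rewrite !mxE.
have symp i k : \sum_j (X i j * Z k j + Z i j * X k j) = 0.
  have : comm_mx (pauli C (v i)) (pauli C (v k)).
    have := commP i k; rewrite /comm_mx !PE -!scalemxAl -!scalemxAr !scalerA.
    by rewrite [_ ^+ s k * _]mulrC; apply: scalerI; rewrite mulf_neq0 ?signr_eq0.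
  by move/pauli_comm_isotropic => vik0; rewrite -[RHS]vik0; apply: eq_bigr => j _; rewrite !mxE.
have [|I fullX'] := row_full_exchange _ rankXZ.
  apply/matrixP => i k; apply: F2_add_eq0; rewrite !mxE -big_split -[RHS](symp i k).
  by apply: eq_bigr => j _; rewrite !mxE.
set X' := \matrix_(i, j) _ in fullX'.
pose Z' := \matrix_(i, j) if j \in I then Z i j else X i j.
have symp' : X' *m Z'^T = Z' *m X'^T.
  apply/matrixP => i k; apply: F2_add_eq0; rewrite !mxE -big_split -[RHS](symp i k).
  by apply: eq_bigr => j _; rewrite !mxE; case: ifP => // _; rewrite addrC.
have [B BX'] := row_fullP fullX'.
pose A := Z'^T *m B^T.
(* By isotropy [X' *m Z'^T *m B^T = Z' *m (B *m X')^T], and [B] is a left inverse of [X']. Applying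
   [B] to this identity then gives [A^T = B *m Z' = A]. *)
have Z'E : Z' = X' *m A by rewrite mulmxA symp' -mulmxA -trmx_mul BX' trmx1 mulmx1.
have symA : A^T = A.
  by rewrite trmx_mul !trmxK {1}Z'E mulmxA BX' mul1mx.
pose ps := [pred p : 'I_n * 'I_n | (p.1 < p.2)%N && (A p.1 p.2 != 0)].
exists (enum (~: I)), (enum ps), (enum [pred q | A q q != 0]), (enum 'I_n) => U.
have dps : all (fun p => p.1 != p.2) (enum ps).
  by apply/allP => p; rewrite mem_enum => /andP[lt12 _]; rewrite -val_eqE neq_ltn lt12.
have actH1 := H_stage_acts C (enum_uniq (mem (~: I))).
have actH4 := H_stage_acts C (enum_uniq 'I_n).
have actS := S_stage_acts C (enum [pred q | A q q != 0]).
have [uU actU] :=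
  acts_as_mul (acts_as_mul (acts_as_mul actH4 actS) (CZ_stage_acts C dps)) actH1.
split=> // [|i].
  by rewrite mul1n -cardE (leq_trans (max_card _)) // card_prod card_ord.
have swap1 : swap_on (mem (enum (mem (~: I)))) (v i) = (row i X', row i Z').
  by congr pair; apply/rowP => j; rewrite !mxE mem_enum inE; case: (j \in I).
have shearA : shear A (row i X', row i Z') = (row i X', 0).
  by rewrite /shear /= -row_mul -Z'E F2_addxx.
have swap2 : swap_on (mem (enum 'I_n)) (row i X', 0) = (0, row i X').
  by congr pair; apply/rowP => j; rewrite mxE mem_enum.
have [e] := actU (v i).
(* The S and CZ shears add up to the shear by [A], which clears [Z'] because [Z' + Z' = 0]. *)
rewrite /= swap1 shear_comp !big_enum -symmetric_F2_sum // shearA swap2 => Ue.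
(* The original sign and the conjugation sign combine by parity; a zero first bit leaves only
   [sigma_i] and [sigma_z]. *)
exists (odd (s i + e)), (fun j => pauli_factor C 0 (X' i j)); split.
  by move=> j; case: (F2P (X' i j)) => ->; rewrite !inE eqxx ?orbT.
rewrite PE -scalemxAr -scalemxAl Ue scalerA -exprD signr_odd; congr (_ *: _).
by apply: eq_tensor => j; rewrite !mxE.
Qed.
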